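(* Let $\mathcal{H}_k$ be an analytic tridiagonal space corresponding to the orthonormal basis $\{f_n\}_{n\ge 0}$, $f_n(z)=(a_n+b_nz)z^n$, and let $L_{M_z}=(M_z^*M_z)^{-1}M_z^*$ be the Shimorin left inverse of the shift $M_z$ on $\mathcal{H}_k$. For $n\ge 1$ put $d_n=\frac{b_n}{a_n}-\frac{b_{n-1}}{a_{n-1}}$. Then $L_{M_z}=L$, where $L$ is the bounded operator on $\mathcal{H}_k$ whose matrix $\ell_{mn}=\langle Lf_n,f_m\rangle$ ($m,n\ge0$) with respect to $\{f_n\}_{n\ge 0}$ is $$\ell_{mn}=\begin{cases}\dfrac{a_{m+1}}{a_m} & n=m+1,\\[2mm] d_m & n=m\ge 1,\\[1mm] (-1)^{m-n}\,\dfrac{d_n\,b_nb_{n+1}\cdots b_{m-1}}{a_{n+1}a_{n+2}\cdots a_m} & 1\le n<m,\\[2mm] 0 & \text{otherwise.}\end{cases}$$ In particular, $L_{M_z}f_0=0$ and $$L_{M_z}f_n=\frac{a_n}{a_{n-1}}f_{n-1}+d_nf_n-d_n\left(\sum_{m=0}^\infty(-1)^m\frac{\prod_{j=0}^m b_{n+j}}{\prod_{j=0}^m a_{n+1+j}}\,f_{n+1+m}\right)\qquad(n\ge 1),$$ and $(\ell_{mn})_{m,n\ge0}$ is the matrix representation of $L_{M_z}$ with respect to the orthonormal basis $\{f_n\}_{n\ge 0}$.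
   Context: $\mathbb{D}$ is the open unit disc, $\mathcal{O}(\mathbb{D})$ the space of analytic functions on $\mathbb{D}$. For a positive definite scalar kernel $k$ on $\mathbb{D}$, analytic in the first variable, $\mathcal{H}_k$ is its reproducing kernel Hilbert space of analytic functions, and the shift $M_z$ is $(M_zf)(w)=wf(w)$. A semi-analytic tridiagonal space is such an $\mathcal{H}_k$ with $\mathbb{C}[z]\subseteq\mathcal{H}_k\subseteq\mathcal{O}(\mathbb{D})$ for which there are complex scalars $\{a_n\}_{n\ge 0}$, $\{b_n\}_{n\ge 0}$ with $a_n\ne 0$ for all $n$, $\sup_{n}|a_n/a_{n+1}|<\infty$, $\limsup_{n}|b_n/a_{n+1}|<1$, and such that $f_n(z)=(a_n+b_nz)z^n$, $n\ge 0$, form an orthonormal basis of $\mathcal{H}_k$ (so $k(z,w)=\sum_{n\ge0}f_n(z)\overline{f_n(w)}$). These conditions ensure that $M_z$ is bounded on $\mathcal{H}_k$. It is an analytic tridiagonal space if in addition $\{|a_n/a_{n+1}|\}_{n\ge 0}$ is bounded away from zero. The paper establishes separately that in an analytic tridiagonal space $M_z$ is left-invertible (so $M_z^*M_z$ is invertible) and that the matrix $(\ell_{mn})$ defines a bounded operator. *)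

(* Defs.v *)
From HB Require Import structures.
From mathcomp Require Import all_boot all_order all_algebra.
From mathcomp Require Import all_classical all_reals all_analysis.
From mathcomp Require Import complex.
Set Implicit Arguments.
Unset Strict Implicit.
Unset Printing Implicit Defensive.
Import Order.TTheory GRing.Theory Num.Theory Num.Def.
Import numFieldNormedType.Exports.
Local Open Scope classical_set_scope.
Local Open Scope ring_scope.

Definition disc (R : realType) : Type := {w : R[i] | `|w| < 1}.

(* `|z| has type R[i]; modulus z is the same number as an element of R. *)
Definition modulus (R : realType) (z : R[i]) : R := ComplexField.Normc.normc z.

Definition analytic_on_disc (R : realType) (g : disc R -> R[i]) : Prop :=
  forall w0 : disc R, exists2 r : R, 0 < r &
    exists c : nat -> R[i], forall w : disc R,
      modulus (sval w - sval w0) < r ->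
      series (fun n => c n * (sval w - sval w0) ^+ n : R[i]^o) @ \oo
        --> (g w : R[i]^o).

Definition positive_definite (R : realType) (k : disc R -> disc R -> R[i])
    : Prop :=
  forall (n : nat) (w : 'I_n -> disc R) (c : 'I_n -> R[i]),
    0 <= \sum_(i < n) \sum_(j < n) (c i)^* * c j * k (w i) (w j).

(* The Hilbert space of functions on the disc with reproducing kernel k.  Its
   elements are abstract vectors, which the injection feval identifies with
   functions.  The inner product is linear in the first argument and conjugate
   linear in the second. *)
Record rkhs (R : realType) (k : disc R -> disc R -> R[i]) := RKHS {
  carrier :> completeNormedModType R[i];
  dot : {dot carrier for (@conjC R[i])};
  normE : forall f : carrier, `|f| ^+ 2 = dot f f;
  feval : {linear carrier -> (disc R -> R[i]^o)};
  feval_inj : injective feval;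
  reproducing : forall w : disc R, exists2 kw : carrier,
    (forall z : disc R, feval kw z = k z w) &
    forall f : carrier, feval f w = dot f kw }.
Arguments dot {R k H} : rename.
Arguments feval {R k H} : rename.

Section Operators.
Variables (R : realType) (k : disc R -> disc R -> R[i]) (H : rkhs k).
Implicit Types (S T : H -> H) (e : nat -> H) (f g h : H).

Definition bounded_operator T : Prop :=
  linear T /\ exists M : R, forall f, `|T f| <= M%:C%C * `|f|.

(* mulz (the shift M_z), op_adjoint and op_inverse are total: each returns the unique
   object with the defining property when there is one (lemmas mulzP,
   op_adjointP and op_inverseP below) and an irrelevant value otherwise. *)

Definition mulz : H -> H := fun f =>
  xget 0 [set g | forall w : disc R, feval g w = sval w * feval f w].

Definition op_adjoint T : H -> H := fun g =>
  xget 0 [set h | forall f, dot (T f) g = dot f h].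

Definition op_inverse T : H -> H :=
  xget (fun=> 0) [set S | [/\ bounded_operator S, cancel T S & cancel S T]].

Definition shimorin_left_inverse T : H -> H :=
  op_inverse (op_adjoint T \o T) \o op_adjoint T.

Definition orthonormal_basis e : Prop :=
  (forall m n, dot (e m) (e n) = (m == n)%:R) /\
  dense [set f | exists n (c : nat -> R[i]), f = \sum_(i < n) c i *: e i].

Lemma mulzP f g :
  (forall w, feval g w = sval w * feval f w) -> mulz f = g.
Proof.
move=> gE; rewrite /mulz; case: xgetP => [h _ hE|/(_ g)//].
by apply: feval_inj; apply/funext => w; rewrite gE -hE.
Qed.

Lemma dot_inj g h : (forall f, dot f g = dot f h) -> g = h.
Proof.
move=> gh; apply/eqP; rewrite -subr_eq0 -(dnorm_eq0 dot).
by rewrite linearB /= gh subrr.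
Qed.

Lemma op_adjointP T S :
  (forall f g, dot (T f) g = dot f (S g)) -> op_adjoint T = S.
Proof.
move=> TS; apply/funext => g; rewrite /op_adjoint.
case: xgetP => [h _ hE|/(_ (S g))]; last by move=> /(_ (TS^~ g)).
by apply: dot_inj => f; rewrite -hE TS.
Qed.

Lemma op_inverseP T S :
  bounded_operator S -> cancel T S -> cancel S T -> op_inverse T = S.
Proof.
move=> bS TS ST; rewrite /op_inverse; case: xgetP => [S' _ [_ TS' _]|/(_ S) []//].
by apply/funext => f; rewrite -[in LHS](ST f) TS'.
Qed.

End Operators.

Section Tridiagonal.
Variables (R : realType) (k : disc R -> disc R -> R[i]) (H : rkhs k).
Variables (a b : nat -> R[i]) (e : nat -> H).

Record semi_analytic_tridiagonal : Prop := {
  kernel_posdef : positive_definite k;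
  kernel_analytic : forall w, analytic_on_disc (k^~ w);
  poly_sub : forall p : {poly R[i]},
    exists h : H, forall w, feval h w = p.[sval w];
  sub_analytic : forall h : H, analytic_on_disc (feval h);
  a_neq0 : forall n, a n != 0;
  ratio_sup :
    (ereal_sup (range (fun n => (modulus (a n / a n.+1))%:E)) < +oo)%E;
  ratio_limsup :
    (limn_esup (fun n => (modulus (b n / a n.+1))%:E) < 1%:E)%E;
  basisE : forall n w, feval (e n) w = (a n + b n * sval w) * sval w ^+ n;
  basis_orthonormal : orthonormal_basis e }.

Definition analytic_tridiagonal : Prop :=
  semi_analytic_tridiagonal /\
  exists2 c : R, 0 < c & forall n, c <= modulus (a n / a n.+1).

End Tridiagonal.

Section Coefficients.
Variables (R : realType) (a b : nat -> R[i]).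

(* Only used for n >= 1. *)
Definition dcoef (n : nat) : R[i] := b n / a n - b n.-1 / a n.-1.

Definition ell (m n : nat) : R[i] :=
  if n == m.+1 then a m.+1 / a m
  else if (n == m) && (0 < m)%N then dcoef m
  else if (0 < n < m)%N then
    (-1) ^+ (m - n) * (dcoef n * \prod_(n <= j < m) b j
                       / \prod_(n.+1 <= j < m.+1) a j)
  else 0.

End Coefficients.

(* Main.v *)
From HB Require Import structures.
Require Import Defs.
From mathcomp Require Import all_boot all_order all_algebra.
From mathcomp Require Import all_classical all_reals all_analysis.
From mathcomp Require Import complex.
Import Order.TTheory GRing.Theory Num.Theory Num.Def.
Import numFieldNormedType.Exports.
Local Open Scope classical_set_scope.
Local Open Scope ring_scope.

(** Write g_n for the function a_n z^n and c_n = b_n / a_(n+1), so that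
    f_n = g_n + c_n g_(n+1).  In terms of the weighted shift W f_n = c_n f_(n+1)
    this says that the operator G with G f_n = g_n inverts I + W.  Since
    limsup |c_n| < 1, the products of m consecutive c_j decay geometrically in m,
    uniformly in the starting index; these products are the weights of W^m, hence
    the Neumann series of I + W converges and G exists as a bounded operator
    [neumann_series, ratio_prod_geometric].

    On the g_n the shift is the plain weighted shift z g_n = (a_n / a_(n+1)) g_(n+1).
    So, with S f_n = (a_n / a_(n+1)) f_(n+1),
       M_z = G S (I + W),
    which is bounded because the ratios a_n / a_(n+1) are [mulz_factored].  As these
    ratios are also bounded away from zero, S has a bounded left inverse B with
    B f_(n+1) = (a_(n+1) / a_n) f_n, and
       L = G B (I + W) (I - P),   P the orthogonal projection onto f_0,
    is bounded and satisfies L M_z = I and M_z L = I - P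
    [cancel_factored_shift, factored_shift_left_inverse].

    A bounded left inverse L for which M L is self-adjoint must be the Shimorin left
    inverse: (M^* M)^(-1) = L L^* and L L^* M^* = L (M L)^* = L M L = L
    [shimorin_left_inverseE].  The formula for L f_n comes from expanding
    G f_n = sum_m (-W)^m f_n, and the matrix is read off from it.

    The Hilbert space facts behind this are a Riesz--Fischer theorem for orthogonal
    series, from which come operators with prescribed orthogonal images of the basis
    [orthogonal_operator] and adjoints of bounded operators [adjoint_exists]. *)

(** * Estimates with complex-valued norms *)
Section ComplexBounds.
Variable R : realType.
Implicit Types (V : normedModType R[i]) (x : R[i]).

Lemma ge0_RRe x : 0 <= x -> x = (complex.Re x)%:C%C.
Proof. by move=> x0; rewrite RRe_real// ger0_real. Qed.

Lemma norm_modulus x : `|x| = (modulus x)%:C%C.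
Proof. by case: x. Qed.

(** The norms are complex numbers, whose order is partial; convergence of the
    geometric sequence is obtained from its real part. *)
Lemma cvg_le_geometric V (u : nat -> V) (l : V) (c x : R[i]) :
  0 <= x -> x < 1 -> (forall n, `|l - u n| <= c * x ^+ n) -> u @ \oo --> l.
Proof.
move=> x0 x1 ul; apply/cvgrPdist_le => e e0.
have c0 : 0 <= c by have := ul 0%N; rewrite expr0 mulr1; exact: le_trans.
have := cvg_geometric (complex.Re c) (z := complex.Re x).
have xE := ge0_RRe x x0; have cE := ge0_RRe c c0; have eE := ge0_RRe e (ltW e0).
rewrite ger0_norm; last by rewrite -ler0c -xE.
have /[swap]/[apply] : complex.Re x < 1 by rewrite -ltcR -xE.
move=> /cvgrPdist_le/(_ (complex.Re e)).
have /[swap]/[apply] : 0 < complex.Re e by rewrite -ltcR -eE.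
apply: filterS => n; rewrite sub0r normrN /geometric /= => ne.
apply: le_trans (ul n) _; rewrite xE cE eE -rmorphXn -rmorphM /= lecR.
exact: le_trans (ler_norm _) ne.
Qed.

Lemma cvg_norm_le V (u : nat -> V) (l : V) (B : R[i]) :
  u @ \oo --> l -> (forall n, `|u n| <= B) -> `|l| <= B.
Proof.
move=> /cvgrPdist_le ul uB; apply/ler_addgt0Pr => e /ul[n _ /(_ n (leqnn n)) ne].
by rewrite -(subrK (u n) l) addrC (le_trans (ler_normD _ _))// lerD.
Qed.

Lemma cvg_expr0 (z : R[i]) : `|z| < 1 -> (fun n => z ^+ n : R[i]^o) @ \oo --> (0 : R[i]^o).
Proof.
move=> z1; apply: (cvg_le_geometric _ _ _ 1 `|z|) => // n.
by rewrite sub0r normrN normrX mul1r.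
Qed.

End ComplexBounds.
Arguments ge0_RRe {R}.
Arguments norm_modulus {R}.
Arguments cvg_le_geometric {R V}.
Arguments cvg_norm_le {R V}.
Arguments cvg_expr0 {R}.

(** * Hilbert spaces and orthogonal series *)
Section HilbertSpace.
Variables (R : realType) (k : disc R -> disc R -> R[i]) (H : rkhs k).
Implicit Types (x y h g : H) (e v : nat -> H) (T : H -> H).

Lemma dot_conj x y : dot x y = (dot y x)^*.
Proof. by have := hermC dot x y; rewrite expr0 mul1r. Qed.

(** Cauchy--Schwarz: the component of [x] orthogonal to [y] has nonnegative
    square norm. *)
Lemma norm_dot_le x y : `|dot x y| <= `|x| * `|y|.
Proof.
rewrite -(@ler_pXn2r _ 2)// ?nnegrE ?mulr_ge0// exprMn !normE.
have [->|y0] := eqVneq y 0; first by rewrite linear0r normr0 expr0n/= mulr_ge0 ?dnorm_ge0.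
have dy0 : 0 < dot y y by rewrite dnorm_gt0.
have := dnorm_ge0 dot (x - (dot x y / dot y y) *: y).
set c := dot x y / dot y y.
have -> : dot (x - c *: y) (x - c *: y) = dot x x - `|dot x y| ^+ 2 / dot y y.
  have cy : dot (x - c *: y) (c *: y) = 0.
    by rewrite linearZr_LR /= linearBl linearZl_LR /= /c divfK ?gt_eqF// subrr mulr0.
  rewrite linearBr /= cy subr0 linearBl linearZl_LR /= (dot_conj y x).
  by rewrite normCK /c mulrAC.
by rewrite subr_ge0 ler_pdivrMr.
Qed.

Lemma cvg_dotl (u : nat -> H) x y :
  u @ \oo --> x -> (fun n => dot (u n) y : R[i]^o) @ \oo --> (dot x y : R[i]^o).
Proof.
move=> /cvgrPdist_lt ux; apply/cvgrPdist_le => e e0.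
have d0 : 0 < e / (`|y| + 1) by rewrite divr_gt0// ltr_wpDl.
apply: filterS (ux _ d0) => n un; rewrite -linearBl.
apply: le_trans (norm_dot_le _ _) _.
apply: le_trans (ler_wpM2r _ (ltW un)) _; first exact: normr_ge0.
rewrite mulrAC ler_pdivrMr ?ltr_wpDl// ler_wpM2l ?lerDl ?ler01//; exact: ltW.
Qed.

Lemma bounded_operator_linear T :
  bounded_operator T -> exists T' : {linear H -> H}, T = T'.
Proof.
move=> [linT _]; pose t := GRing.isLinear.Build R[i] H H *:%R T linT.
by exists (HB.pack_for {linear H -> H} T t).
Qed.

Lemma bounded_operator_sub T x y : bounded_operator T -> T (x - y) = T x - T y.
Proof. by move=> /bounded_operator_linear[T' ->]; rewrite linearB. Qed.

Lemma bounded_operator_scale T (c : R[i]) x : bounded_operator T -> T (c *: x) = c *: T x.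
Proof. by move=> /bounded_operator_linear[T' ->]; rewrite linearZ. Qed.

Lemma bounded_operator0 T : bounded_operator T -> T 0 = 0.
Proof. by move=> /bounded_operator_linear[T' ->]; rewrite linear0. Qed.

Lemma cvg_bounded_operator T (u : nat -> H) x :
  bounded_operator T -> u @ \oo --> x -> (T \o u) @ \oo --> T x.
Proof.
move=> bT /cvgrPdist_lt ux; apply/cvgrPdist_le => e e0.
have [T' T'E] := bounded_operator_linear _ bT; case: bT => _ [M TM].
have d0 : 0 < e / (`|M%:C%C| + 1) by rewrite divr_gt0// ltr_wpDl.
apply: filterS (ux _ d0) => n un; rewrite T'E /= -linearB -T'E.
apply: le_trans (TM _) _.
apply: (@le_trans _ _ (`|M%:C%C| * `|x - u n|)).
  by rewrite ler_wpM2r// real_ler_norm// complex_real.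
apply: le_trans (ler_wpM2l _ (ltW un)) _ => //.
rewrite mulrCA; apply: ler_piMr; first exact: ltW.
by rewrite ler_pdivrMr ?ltr_wpDl// mul1r lerDl.
Qed.

Lemma bounded_operator_norm T :
  bounded_operator T -> exists2 M : R[i], 0 <= M & forall x, `|T x| <= M * `|x|.
Proof.
move=> [_ [M TM]]; exists `|M%:C%C| => // x; apply: le_trans (TM x) _.
by rewrite ler_wpM2r// real_ler_norm// complex_real.
Qed.

Lemma bounded_operatorI T (M : R[i]) :
  linear T -> 0 <= M -> (forall x, `|T x| <= M * `|x|) -> bounded_operator T.
Proof.
by move=> linT M0 TM; split=> //; exists (complex.Re M) => x; rewrite -ge0_RRe.
Qed.

Lemma bounded_operator_comp S T :
  bounded_operator S -> bounded_operator T -> bounded_operator (S \o T).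
Proof.
move=> bS bT; have [S' SE] := bounded_operator_linear _ bS.
have [T' TE] := bounded_operator_linear _ bT.
have [M M0 SM] := bounded_operator_norm _ bS.
have [N N0 TN] := bounded_operator_norm _ bT.
apply: (bounded_operatorI _ (M * N)); rewrite ?mulr_ge0//.
  by rewrite SE TE => a x y /=; rewrite !linearP.
by move=> x /=; rewrite (le_trans (SM _))// -mulrA ler_wpM2l.
Qed.

Lemma bounded_operatorB S T :
  bounded_operator S -> bounded_operator T -> bounded_operator (fun x => S x - T x).
Proof.
move=> bS bT; have [S' SE] := bounded_operator_linear _ bS.
have [T' TE] := bounded_operator_linear _ bT.
have [M M0 SM] := bounded_operator_norm _ bS.
have [N N0 TN] := bounded_operator_norm _ bT.
apply: (bounded_operatorI _ (M + N)); rewrite ?addr_ge0//.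
  by rewrite SE TE => a x y /=; rewrite (linearP S') (linearP T') scalerBr opprD addrACA.
by move=> x /=; rewrite (le_trans (ler_normB _ _))// mulrDl lerD.
Qed.

Lemma bounded_operator_id : bounded_operator (@idfun H).
Proof. by apply: (bounded_operatorI _ 1) => // x; rewrite mul1r. Qed.

Definition orthogonal_family v := forall m n, m != n -> dot (v m) (v n) = 0.

Lemma dnorm_sum v (m n : nat) : orthogonal_family v ->
  dot (\sum_(m <= i < n) v i) (\sum_(m <= i < n) v i) =
  \sum_(m <= i < n) dot (v i) (v i).
Proof.
move=> ov; have [mn|/ltnW nm] := leqP m n; last first.
  by rewrite !(big_geq nm) linear0r.
elim: n mn => [|n IHn]; first by rewrite leqn0 => /eqP ->; rewrite !big_geq// linear0r.
rewrite leq_eqVlt => /predU1P[->|mn]; first by rewrite !(big_geq (leqnn _)) linear0r.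
rewrite !big_nat_recr//= hnormDd /= ?IHn//.
rewrite linear_sumlz /= big_nat big1// => i /andP[_ ni].
by rewrite ov// ltn_eqF.
Qed.

(** Riesz--Fischer: by Pythagoras the tails of the series are as small as those of
    the convergent real series of square norms, so completeness applies. *)
Lemma orthogonal_series_cvg v (M : R[i]) : orthogonal_family v ->
  (forall n, \sum_(0 <= i < n) dot (v i) (v i) <= M) ->
  exists2 s, series v @ \oo --> s & `|s| ^+ 2 <= M.
Proof.
move=> ov vM.
pose r i := complex.Re (dot (v i) (v i)).
have rE i : dot (v i) (v i) = (r i)%:C%C by rewrite -ge0_RRe// dnorm_ge0.
have M0 : 0 <= M by have := vM 0%N; rewrite big_geq.
have cr : cvgn (series r).
  apply: nondecreasing_is_cvgn.
    apply: nondecreasing_series => n _ _.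
    by rewrite -ler0c -rE dnorm_ge0.
  exists (complex.Re M) => _ [n _ <-].
  rewrite -lecR -ge0_RRe//; apply: le_trans (vM n).
  by rewrite /series/= rmorph_sum/= le_eqVlt; apply/orP; left; apply/eqP/eq_bigr.
have : cvg (series v @ \oo).
  apply/cauchy_cvgP/cauchy_seriesP => e e0.
  have eE := ge0_RRe e (ltW e0).
  have e'0 : 0 < complex.Re e by rewrite -ltcR -eE.
  move/cauchy_cvgP/cauchy_seriesP: cr => /(_ (complex.Re e ^+ 2)).
  rewrite exprn_gt0// => /(_ isT); apply: filterS => -[m n] /= mn.
  rewrite -(@ltr_pXn2r _ 2)// ?nnegrE ?(ltW e0)//.
  rewrite normE/= dnorm_sum// (eq_bigr _ (fun i _ => rE i)).
  rewrite -rmorph_sum/= eE -rmorphXn/= ltcR.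
  exact: le_lt_trans (ler_norm _) mn.
move=> /cvg_ex[s vs]; exists s => //.
have := cvg_norm_le _ _ (sqrtC M) vs.
rewrite -[X in _ -> _ <= X]sqrtCK => sM.
rewrite ler_pXn2r ?nnegrE ?sqrtC_ge0//; apply: sM => n.
rewrite -(@ler_pXn2r _ 2)// ?nnegrE ?sqrtC_ge0// sqrtCK.
by rewrite /series /= normE /= dnorm_sum.
Qed.

Section Basis.
Variable e : nat -> H.
Hypothesis eB : orthonormal_basis e.

Lemma basis_dot m n : dot (e m) (e n) = (m == n)%:R.
Proof. by case: eB => + _; apply. Qed.

Lemma norm_basis n : `|e n| = 1.
Proof.
by apply: (pexpIrn (n := 2)); rewrite ?nnegrE// expr1n normE basis_dot eqxx.
Qed.

Lemma basis_scale_orthogonal (c : nat -> R[i]) :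
  orthogonal_family (fun n => c n *: e n).
Proof.
move=> m n /negPf mn.
by rewrite linearZl_LR linearZr_LR/= basis_dot mn mulr0 mulr0.
Qed.

Lemma dnorm_basis_scale (a : R[i]) n : dot (a *: e n) (a *: e n) = `|a| ^+ 2.
Proof. by rewrite dnormZ basis_dot eqxx mulr1. Qed.

Lemma dot_partial_sum (c : nat -> R[i]) n m :
  dot (\sum_(0 <= i < n) c i *: e i) (e m) = if (m < n)%N then c m else 0.
Proof.
rewrite linear_sumlz /=; under eq_bigr do rewrite linearZl_LR/= basis_dot.
case: ifPn => [mn|]; last rewrite -leqNgt => nm.
  rewrite big_mkord (bigD1 (Ordinal mn))//= eqxx mulr1 big1 ?addr0// => i im.
  by rewrite (_ : (_ == _ :> nat) = false) ?mulr0//; apply/negbTE.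
by rewrite big_nat big1// => i /andP[_ ni]; rewrite ltn_eqF ?mulr0// (leq_trans ni).
Qed.

Lemma bessel x n : \sum_(0 <= i < n) `|dot x (e i)| ^+ 2 <= `|x| ^+ 2.
Proof.
pose p := \sum_(0 <= i < n) dot x (e i) *: e i.
have pp : dot p p = \sum_(0 <= i < n) `|dot x (e i)| ^+ 2.
  rewrite dnorm_sum; last exact: basis_scale_orthogonal.
  by apply: eq_bigr => i _; rewrite dnorm_basis_scale.
have xp : dot x p = dot p p.
  rewrite pp linear_sumr /=; apply: eq_bigr => i _.
  by rewrite linearZr_LR/= normCK mulrC.
rewrite normE -pp -subr_ge0 -[X in 0 <= X](_ : dot (x - p) (x - p) = _) ?dnorm_ge0//.
by rewrite linearBl /= !linearBr/= (dot_conj p x) xp -dot_conj subrr subr0.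
Qed.

(** The span of the basis is dense: an approximation [w] of [z := x - y] in it is
    orthogonal to [z], whence [`|z| ^+ 2 <= `|z - w| * `|z|]. *)
Lemma basis_dot_inj x y : (forall n, dot (e n) x = dot (e n) y) -> x = y.
Proof.
move=> xy; apply/eqP; rewrite -subr_eq0; apply/contraT => z0.
set z := x - y in z0.
have ez n : dot (e n) z = 0 by rewrite linearBr/= xy subrr.
have nz0 : 0 < `|z| by rewrite normr_gt0.
case: eB => _ /(_ (ball z `|z|)) [].
- by exists z; exact: ballxx.
- by exact: ball_open.
move=> w [+ [n [c wE]]]; rewrite -ball_normE /ball_ /= => zw.
have wz : dot w z = 0.
  by rewrite wE linear_sumlz /= big1// => i _; rewrite linearZl_LR/= ez mulr0.
have := norm_dot_le (z - w) z; rewrite linearBl /= wz subr0 -normE normrX normr_id.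
by rewrite expr2 ler_pM2r// lt_geF.
Qed.

Lemma dot_basis_series (c : nat -> R[i]) s m :
  series (fun n => c n *: e n) @ \oo --> s -> dot s (e m) = c m.
Proof.
move=> cs; apply: (@cvg_unique _ (@norm_hausdorff _ R[i]^o) _ _ _ _ (cvg_dotl _ _ (e m) cs)).
apply: cvg_near_cst; exists m.+1 => // n /= mn.
by rewrite /series/= dot_partial_sum mn.
Qed.

Lemma basis_expansion x : series (fun n => dot x (e n) *: e n) @ \oo --> x.
Proof.
have [||s xs _] := orthogonal_series_cvg (fun n => dot x (e n) *: e n) (`|x| ^+ 2).
- exact: basis_scale_orthogonal.
- by move=> n; under eq_bigr do rewrite dnorm_basis_scale; exact: bessel.
suff xE : x = s by rewrite -xE in xs.
apply: basis_dot_inj => n; rewrite dot_conj (dot_conj (e n) s); congr (_^*).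
by rewrite (dot_basis_series _ _ n xs).
Qed.

(** * Operators given on an orthonormal basis *)
Lemma pointwise_lim_linear (U : nat -> H -> H) T :
  (forall n, linear (U n)) -> (forall x, U^~ x @ \oo --> T x) -> linear T.
Proof.
move=> linU UT a x y; apply: (@cvg_unique _ (@norm_hausdorff _ H) _ _ _ _ (UT _)).
have -> : U^~ (a *: x + y) = (fun n => a *: U n x + U n y).
  by apply/funext => n; exact: linU.
apply: cvgD; [apply: cvgZl_tmp|]; exact: UT.
Qed.

(** The image of [x] is the series of the [dot x (e n) *: v n]; Bessel's inequality
    bounds its square norm by [C ^+ 2 * `|x| ^+ 2].  This provides all the
    weighted shifts below without any matrix estimate. *)
Lemma orthogonal_operator v (C : R[i]) :
  orthogonal_family v -> (forall n, `|v n| <= C) ->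
  exists T, [/\ linear T, forall x, `|T x| <= C * `|x| & forall n, T (e n) = v n].
Proof.
move=> ov vC.
have C0 : 0 <= C by exact: le_trans (vC 0%N).
have /choice[T TP] x : exists s, series (fun n => dot x (e n) *: v n) @ \oo --> s
    /\ `|s| ^+ 2 <= (C * `|x|) ^+ 2.
  have [||s xs sx] := orthogonal_series_cvg (fun n => dot x (e n) *: v n) ((C * `|x|) ^+ 2).
  - by move=> m n mn; rewrite linearZl_LR linearZr_LR/= ov// !mulr0.
  - move=> n; rewrite exprMn.
    apply: (@le_trans _ _ (C ^+ 2 * \sum_(0 <= i < n) `|dot x (e i)| ^+ 2)).
      rewrite mulr_sumr; apply: ler_sum => i _.
      by rewrite dnormZ -normE mulrC ler_wpM2r ?exprn_ge0// lerXn2r ?nnegrE.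
    by rewrite ler_wpM2l ?exprn_ge0// bessel.
  by exists s.
exists T; split.
- apply: (pointwise_lim_linear (fun n x => series (fun n => dot x (e n) *: v n) n)).
    move=> n a x y; rewrite /series/= scaler_sumr -big_split; apply: eq_bigr => i _ /=.
    by rewrite linearPl scalerDl scalerA.
  by move=> x; case: (TP x).
- by move=> x; have [_] := TP x; rewrite ler_pXn2r ?nnegrE ?mulr_ge0.
- move=> m; have [em _] := TP (e m).
  apply: (@cvg_unique _ (@norm_hausdorff _ H) _ _ _ _ em).
  apply: cvg_near_cst; exists m.+1 => // n /= mn.
  rewrite /series/= big_mkord (bigD1 (Ordinal mn))//= basis_dot eqxx scale1r.
  rewrite big1 ?addr0// => i im; rewrite basis_dot (_ : (_ == _ :> nat) = false) ?scale0r//.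
  by apply/negbTE; rewrite eq_sym.
Qed.

(** The coefficients [c n] of the adjoint at [y] are forced.  They are square
    summable: for a partial sum [p] of the series, [`|p| ^+ 2 = dot y (T p)], which
    is at most [`|y| * (M * `|p|)]. *)
Lemma adjoint_exists T : bounded_operator T ->
  exists T', bounded_operator T' /\ forall x y, dot (T x) y = dot x (T' y).
Proof.
move=> bT; have [Tl TE] := bounded_operator_linear _ bT.
have [M M0 TM] := bounded_operator_norm _ bT.
pose c y n := dot y (T (e n)).
have /choice[T' TP] y : exists s, series (fun n => c y n *: e n) @ \oo --> s
    /\ `|s| ^+ 2 <= (M * `|y|) ^+ 2.
  have [||s ys sy] := orthogonal_series_cvg (fun n => c y n *: e n) ((M * `|y|) ^+ 2).
  - exact: basis_scale_orthogonal.
  - move=> n; pose p := \sum_(0 <= i < n) c y i *: e i.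
    rewrite -dnorm_sum; last exact: basis_scale_orthogonal.
    rewrite -/p -normE ler_pXn2r ?nnegrE ?mulr_ge0//.
    have [->|p0] := eqVneq `|p| 0; first by rewrite mulr_ge0.
    rewrite -(@ler_pM2r _ `|p|) ?lt_def ?p0 ?normr_ge0//.
    rewrite -expr2 -(normr_id p) -normrX normE normr_id.
    have -> : dot p p = dot y (T p).
      rewrite (dnorm_sum _ _ _ (basis_scale_orthogonal _)) TE /p linear_sum linear_sumr /=.
      apply: eq_bigr => i _.
      by rewrite dnorm_basis_scale linearZ linearZr_LR/= normCK mulrC /c TE.
    by rewrite (le_trans (norm_dot_le _ _))// -mulrA mulrCA ler_wpM2l.
  by exists s.
have T'P x y : dot (T x) y = dot x (T' y).
  have xx := basis_expansion x.
  have := cvg_dotl _ _ (T' y) xx.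
  apply: (@cvg_unique _ (@norm_hausdorff _ R[i]^o)).
  have := cvg_dotl _ _ y (cvg_bounded_operator _ _ _ bT xx).
  apply: cvg_trans; apply: near_eq_cvg; near=> n.
  rewrite /series/= TE linear_sum !linear_sumlz; apply: eq_bigr => i _.
  rewrite linearZ !linearZl_LR/=; congr (_ * _).
  by rewrite [RHS]dot_conj (dot_basis_series _ _ i (TP y).1) -dot_conj TE.
exists T'; split=> //; apply: (bounded_operatorI _ M) => //.
  move=> a x y; apply: dot_inj => z.
  by rewrite -T'P linearPr linearPr/= !T'P.
by move=> y; have [_] := TP y; rewrite ler_pXn2r ?nnegrE ?mulr_ge0.
Unshelve. all: by end_near. Qed.

(** The adjoints have the same basis coefficients, so density enters only through
    [basis_dot_inj]. *)
Lemma bounded_operator_ext S T : bounded_operator S -> bounded_operator T ->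
  (forall n, S (e n) = T (e n)) -> S = T.
Proof.
move=> bS bT ST; apply/funext => x; apply: dot_inj => y.
have [S' [_ S'P]] := adjoint_exists _ bS.
have [T' [_ T'P]] := adjoint_exists _ bT.
rewrite dot_conj (dot_conj y (T x)) S'P T'P; congr ((dot x _)^*).
by apply: basis_dot_inj => n; rewrite -S'P -T'P ST.
Qed.

Lemma cvg_series_norm_le (u : nat -> H) (r : nat -> R) :
  (forall n, `|u n| <= (r n)%:C%C) -> cvgn (series r) -> cvg (series u @ \oo).
Proof.
move=> ur /cauchy_cvgP/cauchy_seriesP cr; apply/cauchy_cvgP/cauchy_seriesP => d d0.
have dE := ge0_RRe d (ltW d0).
have /cr : 0 < complex.Re d by rewrite -ltcR -dE.
apply: filterS => -[m n] /= mn; rewrite dE.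
apply: (@le_lt_trans _ _ (\sum_(m <= i < n) r i)%:C%C).
  by rewrite rmorph_sum/= (le_trans (ler_norm_sum _ _ _))// ler_sum.
by rewrite ltcR (le_lt_trans (ler_norm _)).
Qed.

(** The decay is asked of the powers, up to a constant, because the weighted shift to
    which this is applied has weights below 1 only from some index on.  Both
    identities hold because the partial sums of the series at [h - T h] telescope to
    [h - iter n T h]. *)
Lemma neumann_series T (C x : R[i]) : bounded_operator T -> 0 <= x -> x < 1 ->
  (forall n h, `|iter n T h| <= C * x ^+ n * `|h|) ->
  exists G, [/\ bounded_operator G,
    forall h, series (fun n => iter n T h) @ \oo --> G h,
    forall h, G h - T (G h) = h & forall h, G (h - T h) = h].
Proof.
move=> bT x0 x1 TC; have [Tl TE] := bounded_operator_linear _ bT.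
have xE := ge0_RRe x x0.
have linI n : linear (iter n T).
  elim: n => [//|n IHn] a y z /=; rewrite IHn TE; exact: linearP.
have iterB n h : iter n T (h - T h) = iter n T h - iter n.+1 T h.
  by have := linI n (-1) (T h) h; rewrite !scaleN1r iterSr addrC [h - _]addrC => ->.
have C0 h : 0 <= C * `|h| by have := TC 0%N h; rewrite expr0 mulr1; exact: le_trans.
have itercv h : (fun n => iter n T h) @ \oo --> 0.
  apply: (cvg_le_geometric _ _ (C * `|h|) x) => // n.
  by rewrite sub0r normrN mulrAC.
have /choice[G GP] h : exists g, series (fun n => iter n T h) @ \oo --> g.
  apply/cvg_ex.
  apply: (cvg_series_norm_le _ (geometric (complex.Re (C * `|h|)) (complex.Re x))).
    move=> n; apply: le_trans (TC n h) _.
    by rewrite /geometric/= rmorphM rmorphXn/= -xE -ge0_RRe// mulrAC.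
  apply: is_cvg_geometric_series.
  by rewrite ger0_norm -?ler0c -?ltcR -xE.
have linG : linear G.
  apply: (pointwise_lim_linear (fun n h => series (fun i => iter i T h) n)) => //.
  move=> n a y z.
  rewrite /series/= scaler_sumr -big_split; apply: eq_bigr => i _ /=.
  exact: linI.
have x1' : 0 < 1 - x by rewrite subr_gt0.
have bG : bounded_operator G.
  have Cx : 0 <= `|C| / (1 - x) by rewrite divr_ge0// ltW.
  apply: (bounded_operatorI _ (`|C| / (1 - x))) => // h.
  apply: cvg_norm_le (GP h) _ => n; rewrite /series/=.
  apply: le_trans (ler_norm_sum _ _ _) _.
  apply: (@le_trans _ _ (\sum_(0 <= i < n) C * `|h| * x ^+ i)).
    by apply: ler_sum => i _; rewrite mulrAC TC.
  rewrite -mulr_sumr [leRHS]mulrAC ler_pdivlMr// -(mulrA (C * _)).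
  apply: (@le_trans _ _ (C * `|h| * 1)).
    rewrite ler_wpM2l// big_mkord mulrC -opprB mulNr -subrX1 opprB.
    by rewrite gerBl exprn_ge0.
  by rewrite mulr1 -(ger0_norm (C0 h)) normrM normr_id.
have tele h : series (fun n => iter n T (h - T h)) @ \oo --> h.
  have -> : series (fun n => iter n T (h - T h)) = (fun n => h - iter n T h).
    apply/funext => n; rewrite /series/=.
    rewrite (@telescope_sumr_eq _ 0 n (fun i => - iter i T h))// => [|i _].
      by rewrite opprK addrC.
    by rewrite iterB opprK addrC.
  rewrite -[X in _ --> X]subr0; apply: cvgB => //; exact: cvg_cst.
exists G; split=> // h.
- apply: (@cvg_unique _ (@norm_hausdorff _ H) _ _ _ _ _ (tele h)).
  apply: cvg_trans (cvgB (GP h) (cvg_bounded_operator _ _ _ bT (GP h))).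
  apply: near_eq_cvg; near=> n => /=.
  transitivity (\sum_(0 <= i < n) iter i T h - T (\sum_(0 <= i < n) iter i T h)) => //.
  rewrite /series/= [X in _ - X = _](_ : _ = \sum_(0 <= i < n) T (iter i T h)); last first.
    by rewrite TE linear_sum.
  rewrite -sumrB; apply: eq_bigr => i _.
  by rewrite iterB.
- exact: (@cvg_unique _ (@norm_hausdorff _ H) _ _ _ _ (GP _) (tele h)).
Unshelve. all: by end_near. Qed.

(** The inverse of [M^* M] is [L L^*]: since [M L] is self-adjoint, it equals
    [L^* M^*], and [M^* L^*] is the adjoint of [L M], the identity. *)
Lemma shimorin_left_inverseE M L : bounded_operator M -> bounded_operator L ->
  cancel M L -> (forall x y, dot (M (L x)) y = dot x (M (L y))) ->
  shimorin_left_inverse M = L.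
Proof.
move=> bM bL LM MLs.
have [M' [bM' M'P]] := adjoint_exists _ bM.
have [L' [bL' L'P]] := adjoint_exists _ bL.
have M'E : op_adjoint M = M' by exact: op_adjointP.
have M'L' x : M' (L' x) = x by apply: dot_inj => y; rewrite -M'P -L'P LM.
have L'M' x : L' (M' x) = M (L x) by apply: dot_inj => y; rewrite -L'P -M'P MLs.
rewrite /shimorin_left_inverse M'E (op_inverseP (S := L \o L')).
- by apply/funext => x /=; rewrite L'M' LM.
- exact: bounded_operator_comp.
- by move=> x /=; rewrite L'M' !LM.
- by move=> x /=; rewrite -L'M' !M'L'.
Qed.

Lemma shift_operator (c : nat -> R[i]) (C : R[i]) (m : nat) :
  (forall n, `|c n| <= C) ->
  exists S, [/\ linear S, forall x, `|S x| <= C * `|x|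
    & forall n, S (e n) = c n *: e (n + m)%N].
Proof.
move=> cC; apply: orthogonal_operator.
  move=> i j ij; rewrite linearZl_LR linearZr_LR/= basis_dot eqn_add2r (negPf ij).
  by rewrite !mulr0.
by move=> n; rewrite normrZ norm_basis mulr1.
Qed.

Lemma backward_shift_operator (c : nat -> R[i]) (C : R[i]) :
  (forall n, `|c n| <= C) ->
  exists B, bounded_operator B /\ forall n, B (e n.+1) = c n *: e n.
Proof.
move=> cC; have cC' n : `|(c n)^*| <= C by rewrite norm_conjC.
have [S [linS SC Se]] := shift_operator (fun n => (c n)^*) C 1 cC'.
have C0 : 0 <= C by exact: le_trans (cC 0%N).
have [B [bB SB]] := adjoint_exists _ (bounded_operatorI _ _ linS C0 SC).
exists B; split=> // n; apply: basis_dot_inj => m.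
rewrite -SB Se linearZl_LR/= basis_dot addn1.
by rewrite linearZr_LR/= basis_dot eqSS; case: eqVneq => [->//|]; rewrite !mulr0.
Qed.

Lemma coordinate_projection_bounded : bounded_operator (fun x => dot x (e 0%N) *: e 0%N).
Proof.
apply: (bounded_operatorI _ 1) => // [a x y|x].
  by rewrite linearPl scalerDl scalerA.
by rewrite normrZ norm_basis mulr1 mul1r (le_trans (norm_dot_le _ _))// norm_basis mulr1.
Qed.

End Basis.
End HilbertSpace.
Arguments bounded_operator_sub {R k H}.
Arguments bounded_operator_scale {R k H}.
Arguments bounded_operator0 {R k H}.
Arguments dot_conj {R k H}.
Arguments norm_dot_le {R k H}.
Arguments cvg_dotl {R k H}.
Arguments bounded_operator_linear {R k H}.
Arguments cvg_bounded_operator {R k H}.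
Arguments bounded_operator_norm {R k H}.
Arguments bounded_operatorI {R k H}.
Arguments bounded_operator_comp {R k H}.
Arguments bounded_operatorB {R k H}.
Arguments bounded_operator_id {R k H}.
Arguments basis_dot {R k H e}.
Arguments basis_dot_inj {R k H e}.
Arguments adjoint_exists {R k H e}.
Arguments bounded_operator_ext {R k H e}.
Arguments neumann_series {R k H}.
Arguments shimorin_left_inverseE {R k H e}.
Arguments shift_operator {R k H e}.
Arguments backward_shift_operator {R k H e}.
Arguments coordinate_projection_bounded {R k H e}.

(** * Geometric decay of products *)

(** Only the finitely many entries before [N] can exceed [r].  By induction on
    [N]: a window starting at [0] has one more factor [c 0] than one of the shifted
    sequence, which costs [`|c 0| / r] against the bound. *)
Lemma window_product_bound (K : numFieldType) (c : nat -> K) (N : nat) (r : K) :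
  0 < r -> (forall n, (N <= n)%N -> `|c n| <= r) ->
  exists2 C, 0 <= C & forall n m, `|\prod_(0 <= j < m) c (n + j)%N| <= C * r ^+ m.
Proof.
move=> r0; elim: N c => [|N IHN] c cr.
  exists 1 => // n m; rewrite mul1r normr_prod.
  apply: (@le_trans _ _ (\prod_(0 <= j < m) r)).
    by apply: ler_prod => i _; rewrite normr_ge0 cr.
  by rewrite prodr_const_nat subn0.
have [n Nn|C C0 CP] := IHN (c \o S); first exact: cr.
have c0 : 0 <= `|c 0%N| / r by rewrite divr_ge0// ltW.
(* The term 1 accounts for the empty window, C for those starting after 0. *)
exists (1 + C + `|c 0%N| / r * C); first by rewrite !addr_ge0// mulr_ge0.
move=> [|n] m; last first.
  apply: le_trans (CP n m) _; rewrite ler_wpM2r ?exprn_ge0 ?(ltW r0)//.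
  by rewrite -addrA addrCA lerDl addr_ge0// mulr_ge0.
case: m => [|m].
  by rewrite big_geq// normr1 expr0 mulr1 -addrA lerDl addr_ge0// mulr_ge0.
rewrite big_nat_recl//= normrM.
apply: (@le_trans _ _ (`|c 0%N| * (C * r ^+ m))).
  by rewrite ler_wpM2l//; have := CP 0%N m.
rewrite [leRHS](_ : _ = (1 + C) * r ^+ m.+1 + `|c 0%N| * (C * r ^+ m)).
  by rewrite lerDr mulr_ge0// ?addr_ge0// exprn_ge0// (ltW r0).
rewrite mulrDl; congr (_ + _); rewrite exprS -!mulrA; congr (_ * _).
by rewrite mulrCA mulKf// gt_eqF.
Qed.

(** [r] is kept positive for use in [window_product_bound]. *)
Lemma limn_esup_lt1 (R : realType) (u : nat -> R) :
  (limn_esup (fun n => (u n)%:E) < 1%:E)%E ->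
  exists2 r, 0 < r < 1 & exists N, forall n, (N <= n)%N -> u n <= r.
Proof.
rewrite /limn_esup limf_esupE => /ereal_inf_lt[_ [V [N _ NV] <-]] V1.
have uV n : (N <= n)%N -> ((u n)%:E <= ereal_sup [set (u n)%:E | n in V])%E.
  by move=> Nn; apply: ereal_sup_ubound; exists n => //; exact: NV.
move: V1 uV; case: (ereal_sup _) => [s||]//.
  rewrite lte_fin => s1 us; exists (Num.max s 2^-1).
    by rewrite lt_max invr_gt0 ltr0n orbT gt_max s1 invf_lt1// ltr1n.
  by exists N => n /us; rewrite lee_fin le_max => ->.
move=> _ us; exists 2^-1; first by rewrite invr_gt0 ltr0n invf_lt1// ltr1n.
by exists N => n /us; rewrite leeNy_eq.
Qed.

Lemma ereal_sup_lty_bound (R : realType) (u : nat -> R) :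
  (ereal_sup (range (fun n => (u n)%:E)) < +oo)%E ->
  exists A, forall n, u n <= A.
Proof.
move=> uy.
have uV n : ((u n)%:E <= ereal_sup (range (fun n => (u n)%:E)))%E.
  by apply: ereal_sup_ubound; exists n.
move: uy uV; case: (ereal_sup _) => [s||]// _ us.
  by exists s => n; rewrite -lee_fin.
by exists 0 => n; have := us n; rewrite leeNy_eq.
Qed.

(** * The factorization of the shift *)
Section TridiagonalShift.
Variables (R : realType) (k : disc R -> disc R -> R[i]) (H : rkhs k).
Variables (a b : nat -> R[i]) (f : nat -> H).
Hypothesis hf : analytic_tridiagonal a b f.

Let semi : semi_analytic_tridiagonal a b f := proj1 hf.
Let fB : orthonormal_basis f := basis_orthonormal semi.
Let an0 n : a n != 0 := a_neq0 semi n.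

(** The weights of [- W], so that its [m]-th power maps [f n] to
    [ratio_prod n m *: f (n + m)]. *)
Definition neg_ratio n : R[i] := - (b n / a n.+1).
Definition ratio_prod n m : R[i] := \prod_(0 <= j < m) neg_ratio (n + j)%N.

Lemma ratio_prod0 n : ratio_prod n 0 = 1.
Proof. by rewrite /ratio_prod big_geq. Qed.

Lemma ratio_prodE n m : ratio_prod n m = (-1) ^+ m *
  (\prod_(0 <= j < m) b (n + j)%N / \prod_(0 <= j < m) a (n + j).+1).
Proof.
rewrite /ratio_prod (eq_bigr (fun j => -1 * (b (n + j)%N / a (n + j).+1))).
  by rewrite big_split/= prodr_const_nat subn0 prodf_div.
by move=> j _; rewrite mulN1r.
Qed.

Lemma ratio_prod_range n m : (n <= m)%N -> ratio_prod n (m - n) = (-1) ^+ (m - n) *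
  (\prod_(n <= j < m) b j / \prod_(n.+1 <= j < m.+1) a j).
Proof.
move=> nm; rewrite ratio_prodE; congr (_ * (_ / _)).
  rewrite [RHS](big_addn 0 m n); by apply: eq_bigr => j _; rewrite addnC.
rewrite [RHS](big_addn 0 m.+1 n.+1) subSS; apply: eq_bigr => j _.
by rewrite addnS addnC.
Qed.

Lemma ratio_prodSr n m : ratio_prod n m.+1 = ratio_prod n m * neg_ratio (n + m)%N.
Proof. by rewrite /ratio_prod big_nat_recr. Qed.

Lemma ratio_bound : exists A, forall n, `|a n / a n.+1| <= A.
Proof.
have [A AP] := ereal_sup_lty_bound _ _ (ratio_sup semi).
by exists A%:C%C => n; rewrite norm_modulus lecR.
Qed.

Lemma inv_ratio_bound : exists A, forall n, `|a n.+1 / a n| <= A.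
Proof.
case: hf => _ [c c0 cP]; exists (c^-1)%:C%C => n.
rewrite -[a n.+1 / a n]invrK invf_div normfV norm_modulus -fmorphV/= lecR.
by rewrite lef_pV2 ?posrE// (lt_le_trans c0).
Qed.

Lemma ratio_prod_geometric : exists C r : R[i],
  [/\ 0 <= C, 0 < r < 1 & forall n m, `|ratio_prod n m| <= C * r ^+ m].
Proof.
have [r /andP[r0 r1] [N NP]] := limn_esup_lt1 _ _ (ratio_limsup semi).
have [||C C0 CP] := window_product_bound _ neg_ratio N r%:C%C.
- by rewrite ltcR.
- by move=> n /NP; rewrite /neg_ratio normrN norm_modulus lecR.
by exists C, r%:C%C; split=> //; rewrite !ltcR r0.
Qed.

(** In the notation of the introduction, [T] is [- W] and [G] is the Neumann sum of
    its powers.  The powers are bounded as weighted shifts in their own right, not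
    as powers of [T], which is where the geometric decay of the products is used. *)
Lemma factor_operators_exist : exists G S B T : H -> H,
  [/\ [/\ bounded_operator G, bounded_operator S, bounded_operator B & bounded_operator T],
   [/\ forall n, S (f n) = (a n / a n.+1) *: f n.+1,
       forall n, B (f n.+1) = (a n.+1 / a n) *: f n &
       forall n, T (f n) = neg_ratio n *: f n.+1],
   forall n, series (fun m => ratio_prod n m *: f (n + m)%N) @ \oo --> G (f n),
   forall h, G h - T (G h) = h & forall h, G (h - T h) = h].
Proof.
have [A AP] := ratio_bound.
have [A' A'P] := inv_ratio_bound.
have [C [r [C0 /andP[r0 r1] CP]]] := ratio_prod_geometric.
have [S [linS SA Sf]] := shift_operator fB (fun n => a n / a n.+1) A 1 AP.
have [B [bB Bf]] := backward_shift_operator fB (fun n => a n.+1 / a n) A' A'P.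
have neg_ratio_le n : `|neg_ratio n| <= C * r.
  by have := CP n 1%N; rewrite /ratio_prod big_nat1 addn0 expr1.
have [T [linT TC Tf]] := shift_operator fB neg_ratio (C * r) 1 neg_ratio_le.
have Cr0 : 0 <= C * r by rewrite mulr_ge0// ltW.
have bT : bounded_operator T := bounded_operatorI _ _ linT Cr0 TC.
have bS : bounded_operator S.
  by apply: bounded_operatorI linS _ SA; exact: le_trans (AP 0%N).
have Tf' n : T (f n) = neg_ratio n *: f n.+1 by rewrite Tf addn1.
have bI m : bounded_operator (iter m T).
  elim: m => [|m IHm]; first exact: bounded_operator_id.
  exact: bounded_operator_comp _ _ bT IHm.
have iterTf m n : iter m T (f n) = ratio_prod n m *: f (n + m)%N.
  elim: m => [|m IHm]; first by rewrite /ratio_prod big_geq// scale1r addn0.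
  rewrite iterS IHm; have [T' TE] := bounded_operator_linear _ bT.
  by rewrite TE linearZ -TE/= Tf' scalerA addnS ratio_prodSr.
have TI m h : `|iter m T h| <= C * r ^+ m * `|h|.
  have [W [linW WC Wf]] := shift_operator fB (ratio_prod^~ m) (C * r ^+ m) m (CP^~ m).
  suff -> : iter m T = W by [].
  apply: bounded_operator_ext fB _ _ (bI m) _ _ => [|n]; last by rewrite Wf iterTf.
  by apply: bounded_operatorI linW _ WC; rewrite mulr_ge0// exprn_ge0// ltW.
have [G [bG GP GT TG]] := neumann_series T C r bT (ltW r0) r1 TI.
exists G, S, B, T; split=> //; first split=> //.
  by move=> n; rewrite Sf addn1.
move=> n; under eq_fun do rewrite -iterTf.
exact: GP.
Qed.

Section Factorization.
Variables G S B T : H -> H.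
Hypotheses (bG : bounded_operator G) (bS : bounded_operator S).
Hypotheses (bB : bounded_operator B) (bT : bounded_operator T).
Hypothesis Sf : forall n, S (f n) = (a n / a n.+1) *: f n.+1.
Hypothesis Bf : forall n, B (f n.+1) = (a n.+1 / a n) *: f n.
Hypothesis Tf : forall n, T (f n) = neg_ratio n *: f n.+1.
Hypothesis Gf : forall n, series (fun m => ratio_prod n m *: f (n + m)%N) @ \oo --> G (f n).
Hypothesis GT : forall h, G h - T (G h) = h.
Hypothesis TG : forall h, G (h - T h) = h.

Lemma G_basis_rec n : G (f n) = f n + neg_ratio n *: G (f n.+1).
Proof.
have := TG (f n); rewrite Tf (bounded_operator_sub G)// (bounded_operator_scale G)// => /eqP.
by rewrite subr_eq => /eqP.
Qed.

Lemma dot_G_basis n m : dot (G (f n)) (f m) = if (n <= m)%N then ratio_prod n (m - n) else 0.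
Proof.
apply: (@cvg_unique _ (@norm_hausdorff _ R[i]^o) _ _ _ _ (cvg_dotl _ _ (f m) (Gf n))).
apply: cvg_near_cst; exists (m - n).+1 => // p /= mnp.
rewrite /series/= linear_sumlz /=.
under eq_bigr do rewrite linearZl_LR/= (basis_dot fB).
case: ifPn => [nm|]; last rewrite -ltnNge => mn.
  rewrite big_mkord (bigD1 (Ordinal mnp))//=.
  have -> : (n + (m - n) == m)%N by rewrite subnKC.
  rewrite mulr1 big1 ?addr0// => i im.
  rewrite (_ : (_ == m) = false) ?mulr0//; apply: contraNF im => /eqP im.
  by apply/eqP/val_inj => /=; rewrite -im addKn.
rewrite big1// => i _; rewrite gtn_eqF ?mulr0//.
by rewrite (leq_trans mn)// leq_addr.
Qed.

(** The values at [w] of the partial sums of the Neumann series telescope to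
    [a n * w ^+ n] minus a remainder [q m * w ^+ (n + m)] in which [q] does not
    depend on [w].  The remainder converges for every point of the disc; comparing
    [w] with a point [rho] of larger modulus, its limit at [w] is zero. *)
Lemma feval_G_basis n (w : disc R) : feval (G (f n)) w = a n * sval w ^+ n.
Proof.
pose q m := ratio_prod n m * a (n + m)%N.
have q0 : q 0%N = a n by rewrite /q /ratio_prod big_geq// mul1r addn0.
have qcv (z : disc R) : (fun m => q m * sval z ^+ (n + m) : R[i]^o) @ \oo -->
    (a n * sval z ^+ n - feval (G (f n)) z : R[i]^o).
  have [kz _ kzP] := reproducing H z.
  rewrite kzP.
  apply: cvg_trans (cvgB (cvg_cst (a n * sval z ^+ n : R[i]^o)) (cvg_dotl _ _ kz (Gf n))).
  apply: near_eq_cvg; near=> m.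
  transitivity (a n * sval z ^+ n - dot (\sum_(0 <= j < m) ratio_prod n j *: f (n + j)%N) kz) => //.
  rewrite linear_sumlz/=.
  rewrite (@telescope_sumr_eq _ 0 m (fun i => - (q i * sval z ^+ (n + i))))// => [|j _].
    by rewrite opprK opprD opprK addrCA q0 addn0 subrr addr0.
  rewrite linearZl_LR/= -kzP (basisE semi) /q opprK addrC ratio_prodSr addnS /neg_ratio.
  rewrite mulrDl mulrDr exprS mulrA; congr (_ + _); last by rewrite mulrA.
  by rewrite mulrN !mulNr opprK -!mulrA mulKf// -!mulrA.
(* Any modulus strictly between that of w and 1 would do. *)
have [rho [rho0 wrho rho1]] : exists rho : R[i], [/\ 0 < rho, `|sval w| < rho & rho < 1].
  exists ((`|sval w| + 1) / 2); case: w => w /= w1; split.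
  - by rewrite divr_gt0// ltr_wpDl.
  - exact: (midf_lt w1).1.
  - exact: (midf_lt w1).2.
have Rrho : `|rho| < 1 by rewrite gtr0_norm.
have := qcv (exist _ rho Rrho) => /= qrho.
have wr : `|sval w / rho| < 1 by rewrite normrM normfV (gtr0_norm rho0) ltr_pdivrMr// mul1r.
pose l := a n * rho ^+ n - feval (G (f n)) (exist _ rho Rrho).
have : (fun m => q m * rho ^+ (n + m) * ((sval w / rho) ^+ n * (sval w / rho) ^+ m) : R[i]^o)
    @ \oo --> (l * ((sval w / rho) ^+ n * 0) : R[i]^o).
  apply: cvgM; first exact: qrho.
  by apply: cvgM; [exact: cvg_cst|exact: cvg_expr0].
rewrite !mulr0 => qw0.
have : a n * sval w ^+ n - feval (G (f n)) w = 0.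
  apply: (@cvg_unique _ (@norm_hausdorff _ R[i]^o) _ _ _ _ (qcv w)).
  apply: cvg_trans qw0; apply: near_eq_cvg; near=> m.
  by rewrite -exprD -mulrA -exprMn mulrCA divff ?gt_eqF// mulr1.
by move/eqP; rewrite subr_eq0 => /eqP.
Unshelve. all: by end_near. Qed.

(** These are the formulas for M_z and L of the introduction, with I + W = 1 - T. *)
Definition factored_shift h := G (S (h - T h)).
Definition factored_left_inverse h :=
  let g := h - dot h (f 0%N) *: f 0%N in G (B (g - T g)).
Local Notation M := factored_shift.
Local Notation L := factored_left_inverse.

Lemma bounded_factored_shift : bounded_operator M.
Proof.
apply: bounded_operator_comp _ _ bG _.
apply: bounded_operator_comp _ _ bS _.
exact: bounded_operatorB _ _ (bounded_operator_id) bT.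
Qed.

Lemma bounded_factored_left_inverse : bounded_operator L.
Proof.
have bP := bounded_operatorB _ _ (@bounded_operator_id _ _ H) (coordinate_projection_bounded fB).
apply: bounded_operator_comp _ _ bG _.
apply: bounded_operator_comp _ _ bB _.
exact: bounded_operatorB _ _ bP (bounded_operator_comp _ _ bT bP).
Qed.

Lemma factored_shift_basis n : M (f n) = (a n / a n.+1) *: G (f n.+1)
  + (b n / a n.+2) *: G (f n.+2).
Proof.
rewrite /factored_shift Tf (bounded_operator_sub S)// (bounded_operator_scale S)// !Sf.
rewrite (bounded_operator_sub G)// !(bounded_operator_scale G)// scalerA.
by rewrite -scaleNr /neg_ratio mulNr opprK mulrA mulfVK.
Qed.

(** Point evaluations are inner products with kernel vectors, so that equality of
    the two sides at every vector follows from equality on the basis. *)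
Lemma mulz_factored : @mulz R k H = M.
Proof.
apply/funext => h; apply: mulzP => w.
have [M' [_ M'P]] := adjoint_exists fB M bounded_factored_shift.
have [kw _ kwP] := reproducing H w.
rewrite !kwP M'P (_ : M' kw = (sval w)^* *: kw) ?linearZr_LR/= ?conjCK//.
apply: (basis_dot_inj fB) => n.
rewrite -M'P linearZr_LR/= conjCK factored_shift_basis.
rewrite linearDl/= !(linearZl_LR dot)/= -!kwP !feval_G_basis (basisE semi).
rewrite (mulrA (a n / _)) (mulrA (b n / _)) !mulfVK//.
rewrite !exprS mulrDl mulrDr; congr (_ + _); first exact: mulrCA.
by rewrite mulrCA (mulrA (b n)).
Qed.

(** * The left inverse of the shift *)
Lemma cancel_S_B : cancel S B.
Proof.
move=> h; rewrite -[RHS]/(idfun h) -[B (S h)]/((B \o S) h); congr (_ h).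
apply: (bounded_operator_ext fB) => [||n].
- exact: bounded_operator_comp _ _ bB bS.
- exact: bounded_operator_id.
by rewrite /= Sf (bounded_operator_scale B)// Bf scalerA mulrA mulfVK// divff// scale1r.
Qed.

(** The vectors [G (f n.+1)] are orthogonal to [f 0], hence so is the range of the
    shift and the projection in [factored_left_inverse] has no effect on it. *)
Lemma cancel_factored_shift : cancel M L.
Proof.
move=> h; rewrite -[RHS]/(idfun h) -[L (M h)]/((L \o M) h); congr (_ h).
apply: (bounded_operator_ext fB) => [||n].
- exact: bounded_operator_comp _ _ bounded_factored_left_inverse bounded_factored_shift.
- exact: bounded_operator_id.
have M0 : dot (M (f n)) (f 0%N) = 0.
  by rewrite factored_shift_basis linearDl/= !(linearZl_LR dot)/= !dot_G_basis/= !mulr0 addr0.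
by rewrite /= /factored_left_inverse M0 scale0r subr0 /factored_shift GT cancel_S_B TG.
Qed.

Lemma factored_shift_left_inverse h : M (L h) = h - dot h (f 0%N) *: f 0%N.
Proof.
rewrite -[M (L h)]/((M \o L) h); set P := (fun x => x - dot x (f 0%N) *: f 0%N).
rewrite -[RHS]/(P h); congr (_ h).
have bP : bounded_operator P.
  exact: bounded_operatorB _ _ bounded_operator_id (coordinate_projection_bounded fB).
apply: (bounded_operator_ext fB) => //.
  exact: bounded_operator_comp _ _ bounded_factored_shift bounded_factored_left_inverse.
move=> n; rewrite /= /factored_left_inverse -/(P (f n)).
have -> : P (f n) = if n is 0 then 0 else f n.
  rewrite /P (basis_dot fB); case: n => [|n]; first by rewrite scale1r subrr.
  by rewrite scale0r subr0.
case: n => [|n].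
  rewrite (bounded_operator0 T)// subr0 (bounded_operator0 B)// (bounded_operator0 G)//.
  exact: bounded_operator0 bounded_factored_shift.
rewrite /factored_shift GT.
have SB m : S (B (f m.+1)) = f m.+1.
  by rewrite Bf (bounded_operator_scale S)// Sf scalerA mulrA mulfVK// divff// scale1r.
rewrite [in B _]Tf (bounded_operator_sub B)// (bounded_operator_scale B)//.
by rewrite (bounded_operator_sub S)// (bounded_operator_scale S)// !SB -Tf TG.
Qed.

Lemma shimorin_left_inverse_factored : shimorin_left_inverse (@mulz R k H) = L.
Proof.
rewrite mulz_factored; apply: (shimorin_left_inverseE fB _ _ bounded_factored_shift
  bounded_factored_left_inverse cancel_factored_shift) => x y.
rewrite !factored_shift_left_inverse linearBl linearBr/= linearZl_LR linearZr_LR/=; congr (_ - _).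
by rewrite mulrC -dot_conj.
Qed.

Lemma factored_left_inverse_basis0 : L (f 0%N) = 0.
Proof.
rewrite /factored_left_inverse (basis_dot fB) eqxx scale1r subrr (bounded_operator0 T)// subr0.
by rewrite (bounded_operator0 B)// (bounded_operator0 G).
Qed.

Lemma factored_left_inverse_basisS n :
  L (f n.+1) = (a n.+1 / a n) *: f n + dcoef a b n.+1 *: G (f n.+1).
Proof.
rewrite /factored_left_inverse (basis_dot fB) scale0r subr0 Tf (bounded_operator_sub B)//.
rewrite (bounded_operator_scale B)// !Bf scalerA (bounded_operator_sub G)//.
rewrite (bounded_operator_scale G)// (G_basis_rec n) scalerDr -addrA scalerA; congr (_ + _).
rewrite (bounded_operator_scale G)// -scalerBl; congr (_ *: _).
rewrite /dcoef /neg_ratio /=.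
rewrite mulrN mulNr opprK addrC; congr (_ - _); first by rewrite mulrA mulfVK.
by rewrite mulrC mulrA mulfVK.
Qed.

Lemma dot_factored_left_inverse m n : dot (L (f n)) (f m) = ell a b m n.
Proof.
case: n => [|n]; first by rewrite factored_left_inverse_basis0 linear0l /ell; case: m.
rewrite factored_left_inverse_basisS linearDl/= !(linearZl_LR dot)/=.
rewrite (basis_dot fB) dot_G_basis /ell eqSS.
have [<-|nm] := eqVneq n m; first by rewrite ltnn mulr1 mulr0 addr0.
rewrite mulr0 add0r; have [<-|n1m] := eqVneq n.+1 m.
  by rewrite leqnn subnn ratio_prod0 mulr1.
rewrite andFb (ltn_neqAle n.+1) n1m /=; case: ifP => [n1m'|_]; last by rewrite mulr0.
by rewrite ratio_prod_range// mulrCA !mulrA.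
Qed.

End Factorization.

End TridiagonalShift.
Arguments ratio_prod {R}.
Arguments factor_operators_exist {R k H a b f}.
Arguments shimorin_left_inverse_factored {R k H a b f} hf {G S B T}.
Arguments bounded_factored_left_inverse {R k H a b f} hf {G B T}.
Arguments dot_factored_left_inverse {R k H a b f} hf {G B T}.
Arguments factored_left_inverse_basis0 {R k H a b f} hf {G B T}.
Arguments factored_left_inverse_basisS {R k H a b f} hf {G B T}.

Theorem theorem3p4 (R : realType) (k : disc R -> disc R -> R[i]) (H : rkhs k)
    (a b : nat -> R[i]) (f : nat -> H) (hf : analytic_tridiagonal a b f) :
  let LM : H -> H := shimorin_left_inverse (@mulz R k H) in
  [/\ exists L : H -> H,
        unique (fun T : H -> H => bounded_operator T /\
                  forall m n, dot (T (f n)) (f m) = ell a b m n) L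
        /\ LM = L,
      LM (f 0%N) = 0,
      forall n : nat, (1 <= n)%N ->
        exists2 s : H,
          series (fun m => ((-1) ^+ m * (\prod_(0 <= j < m.+1) b (n + j)%N
                             / \prod_(0 <= j < m.+1) a (n + 1 + j)%N))
                           *: f (n + 1 + m)%N) @ \oo --> s
          & LM (f n) = (a n / a n.-1) *: f n.-1 + dcoef a b n *: f n
                       - dcoef a b n *: s
    & forall m n, dot (LM (f n)) (f m) = ell a b m n].
Proof.
have fB := basis_orthonormal hf.1.
have [G [S [B [T [[bG bS bB bT] [Sf Bf Tf] Gf GT TG]]]]] := factor_operators_exist hf.
have LE := shimorin_left_inverse_factored hf bG bS bB bT Sf Bf Tf Gf GT TG.
have bL := bounded_factored_left_inverse hf bG bB bT.
have Lfm := dot_factored_left_inverse hf bG bB bT Bf Tf Gf TG.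
rewrite LE => LM; split => //.
- exists LM; split=> //; split=> // L' [bL' L'f].
  apply: (bounded_operator_ext fB) => // n; apply: (basis_dot_inj fB) => m.
  by rewrite dot_conj (dot_conj (f m)) L'f Lfm.
- exact: (factored_left_inverse_basis0 hf bG bB bT).
(* The series is the Neumann series of G (f n.+1) without its first term and with
   the opposite sign. *)
- case=> [//|n] _; exists (f n.+1 - G (f n.+1)).
    have := Gf n.+1; rewrite -cvg_shiftS => Gs.
    apply: cvg_trans (cvgB (cvg_cst (f n.+1)) Gs); apply: near_eq_cvg; near=> N.
    transitivity (f n.+1 - \sum_(0 <= m < N.+1) ratio_prod a b n.+1 m *: f (n.+1 + m)%N) => //.
    rewrite big_nat_recl// ratio_prod0 scale1r addn0 opprD addrA subrr add0r -sumrN.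
    apply: eq_bigr => m _; rewrite ratio_prodE -scaleNr addn1 addnS addSn.
    by congr (_ *: _); rewrite exprS mulN1r mulNr opprK.
  by rewrite /LM (factored_left_inverse_basisS hf bG bB Bf Tf TG) scalerBr -addrA subKr.
Unshelve. all: by end_near. Qed.
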